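(* Let $G$ and $G'$ be connected graphs that have no isolated vertices. If the $\operatorname{Z}_+$Ir-TAR graphs of $G$ and $G'$ are isomorphic, then $G$ and $G'$ have the same order and there is a relabeling of the vertices of $G'$ such that $G$ and $G'$ have exactly the same $\operatorname{Z}_+$Ir-sets.
   Context: Graphs are finite, simple, undirected. For a graph $G$, a (standard) fort is a nonempty set $F\subseteq V(G)$ such that $|F\cap N(v)|\neq 1$ for all $v\in V(G)\setminus F$, where $N(v)$ is the open neighborhood. A nonempty $F\subseteq V(G)$ is a PSD fort if, writing $F=F_1\sqcup\dots\sqcup F_k$ where $G[F_1],\dots,G[F_k]$ are the connected components of the induced subgraph $G[F]$, each $F_i$ is a standard fort of $G$. A set $S\subseteq V(G)$ is a $\operatorname{Z}_+$Ir-set if for every $u\in S$ there is a PSD fort $F$ with $S\cap F=\{u\}$. The $\operatorname{Z}_+$Ir-TAR graph of $G$ has as vertices the $\operatorname{Z}_+$Ir-sets of $G$, two being adjacent iff one is obtained from the other by adding or removing exactly one vertex. *)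

(* Defs.v *)
From mathcomp Require Import all_boot.

Set Implicit Arguments.
Unset Strict Implicit.
Unset Printing Implicit Defensive.

Record sgraph := SGraph {
  vertex :> finType;
  adj : rel vertex;
  adj_sym : symmetric adj;
  adj_irr : irreflexive adj }.

Definition connected_graph (G : sgraph) : Prop :=
  0 < #|G| /\ forall x y : G, connect (@adj G) x y.

Definition nbhd (G : sgraph) (v : G) : {set G} := [set w | adj v w].

Definition no_isolated (G : sgraph) : Prop := forall v : G, nbhd v != set0.

Definition fort (G : sgraph) (F : {set G}) : bool :=
  (F != set0) && [forall v in ~: F, #|F :&: nbhd v| != 1].

Definition induced_adj (G : sgraph) (F : {set G}) : rel G :=
  [rel x y | [&& x \in F, y \in F & adj x y]].

Definition components (G : sgraph) (F : {set G}) : {set {set G}} :=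
  equivalence_partition (connect (induced_adj F)) F.

Definition psd_fort (G : sgraph) (F : {set G}) : bool :=
  (F != set0) && [forall C in components F, fort C].

Definition zpir_set (G : sgraph) (S : {set G}) : bool :=
  [forall u in S, exists F : {set G}, psd_fort F && (S :&: F == [set u])].

Definition zpir_sets (G : sgraph) : {set {set G}} := [set S | zpir_set S].

Definition adds_one (T : finType) (A B : {set T}) : bool :=
  [exists v, (v \notin A) && (B == v |: A)].

Definition tar_vertex (G : sgraph) : finType := {S : {set G} | zpir_set S}.

Definition tar_adj (G : sgraph) : rel (tar_vertex G) :=
  [rel A B | adds_one (val A) (val B) || adds_one (val B) (val A)].

Lemma tar_adj_sym (G : sgraph) : symmetric (@tar_adj G).
Proof. by move=> A B; rewrite /tar_adj /= orbC. Qed.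

Lemma tar_adj_irr (G : sgraph) : irreflexive (@tar_adj G).
Proof.
move=> A; rewrite /tar_adj /= orbb; apply/existsP=> -[v /andP[vA /eqP eA]].
by move: vA; rewrite eA setU11.
Qed.

Definition tar_graph (G : sgraph) : sgraph :=
  SGraph (@tar_adj_sym G) (@tar_adj_irr G).

Definition graph_iso (G H : sgraph) : Prop :=
  exists f : G -> H, bijective f /\ forall x y, adj (f x) (f y) = adj x y.

(* Main.v *)
Require Import Defs.
From mathcomp Require Import all_boot.

(** The Z+Ir-sets form a simplicial complex containing every singleton: subsets
    of Z+Ir-sets are Z+Ir-sets, and the whole vertex set of a connected graph is
    a PSD fort. Its TAR graph is a subgraph of the hypercube. An isomorphism f of
    such subgraphs is rigid: it sends the edges at the empty set to edges at
    X := f(0), which defines a map p on vertices, and since two points of the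
    hypercube at distance two have exactly two common neighbours, induction on
    the size of A gives f(A) = X + p(A), with + the symmetric difference.
    Finally, if D and Y + D are both closed under subsets then they coincide: for
    A in D, the set A \ Y is contained in Y + A, so it lies in Y + D, hence
    A :|: Y lies in D, and so does its subset Y + A. *)

Set Implicit Arguments.
Unset Strict Implicit.
Unset Printing Implicit Defensive.

Definition symdiff (T : finType) (A B : {set T}) : {set T} :=
  [set x | (x \in A) (+) (x \in B)].

Definition cube_adj (T : finType) (A B : {set T}) : Prop :=
  exists v, B = symdiff A [set v].

Definition subset_closed (T : finType) (D : pred {set T}) : Prop :=
  forall A B : {set T}, A \subset B -> D B -> D A.

Section SymmetricDifference.

Variable T : finType.
Implicit Types A B C : {set T}.

Lemma symdiffA : associative (@symdiff T).
Proof. by move=> A B C; apply/setP=> x; rewrite !inE addbA. Qed.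

Lemma symdiffK A : involutive (symdiff A).
Proof. by move=> B; apply/setP=> x; rewrite !inE addKb. Qed.

Lemma symdiff0 A : symdiff A set0 = A.
Proof. by apply/setP=> x; rewrite !inE addbF. Qed.

Lemma symdiff1_notin A v : v \notin A -> symdiff A [set v] = v |: A.
Proof.
move=> vA; apply/setP=> x; rewrite !inE addbC.
by case: eqP => [->|//]; rewrite (negbTE vA).
Qed.

Lemma symdiff1_in A v : v \in A -> symdiff A [set v] = A :\ v.
Proof.
move=> vA; apply/setP=> x; rewrite !inE addbC.
by case: eqP => [->|//]; rewrite vA.
Qed.

Lemma imset_symdiff (T' : finType) (p : T -> T') A B :
  injective p -> p @: symdiff A B = symdiff (p @: A) (p @: B).
Proof.
move=> p_inj; apply/setP=> y; rewrite inE.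
case: (boolP (y \in codom p)) => [/codomP[x ->]|yp].
  by rewrite !mem_imset // inE.
have yF C : (y \in p @: C) = false.
  by apply/negP=> /imsetP[x _ ey]; rewrite ey codom_f in yp.
by rewrite !yF.
Qed.

Lemma cube_adj_common A a b C : a != b ->
  cube_adj (symdiff A [set a]) C -> cube_adj (symdiff A [set b]) C ->
  C = A \/ C = symdiff A [set a; b].
Proof.
move=> neq_ab [c ->] [d /setP cd].
have {}cd x : (x == a) (+) (x == c) = (x == b) (+) (x == d).
  by have:= cd x; rewrite !inE -!addbA => /addbI.
have [eac|nac] := eqVneq a c.
  by left; rewrite -eac; apply/setP=> x; rewrite !inE addbK.
(* Evaluating [cd] at [a] forces [a = d]; evaluating it at [b] then forces [b = c]. *)
right; have ebc : b = c.
  have:= cd a; rewrite eqxx (negbTE nac) (negbTE neq_ab) /= => /esym/eqP ead.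
  have:= cd b; rewrite eqxx -ead eq_sym (negbTE neq_ab) /=.
  by move/eqP.
rewrite -ebc -symdiffA; congr symdiff; apply/setP=> x; rewrite !inE.
by have [->|] := eqVneq x a; rewrite ?(negbTE neq_ab).
Qed.

(** Toggling [v] adds it when absent and removes it when present, so TAR adjacency is hypercube
    adjacency. *)
Lemma adds_one_cube_adj A B : reflect (cube_adj A B) (adds_one A B || adds_one B A).
Proof.
apply: (iffP orP) => [[] /existsP[v /andP[nv /eqP ->]]|[v ->]].
- by exists v; rewrite symdiff1_notin.
- by exists v; rewrite symdiff1_in ?setU11 // setU1K.
have [vA|nvA] := boolP (v \in A); [right|left]; apply/existsP; exists v.
  by rewrite symdiff1_in // setD11 setD1K /=.
by rewrite symdiff1_notin // nvA eqxx.
Qed.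

Lemma symdiff_shift_sub (D E : pred {set T}) Y :
  subset_closed D -> subset_closed E -> (forall B, D B = E (symdiff Y B)) ->
  forall A, D A -> E A.
Proof.
move=> cD cE DE A DA.
have : E (A :\: Y).
  apply: cE (_ : E (symdiff Y A)); last by rewrite -DE.
  by apply/subsetP=> x; rewrite !inE; case: (x \in Y).
(* As [A :\: Y] is disjoint from [Y], [DU] places the union [A :|: Y] in [D]. *)
rewrite -[A :\: Y](symdiffK Y) -DE => DU.
rewrite -[A](symdiffK Y) -DE; apply: cD DU.
by apply/subsetP=> x; rewrite !inE; case: (x \in Y); rewrite ?andbF.
Qed.

Lemma symdiff_shift_eq (D E : pred {set T}) Y :
  subset_closed D -> subset_closed E -> (forall B, D B = E (symdiff Y B)) ->
  D =1 E.
Proof.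
move=> cD cE DE A; apply/idP/idP; apply: (symdiff_shift_sub (Y := Y)) => //.
by move=> B; rewrite DE symdiffK.
Qed.

End SymmetricDifference.

(** Only injectivity and preservation of adjacency on [D] are assumed, so the result serves an
    isomorphism and its inverse alike. *)
Lemma cube_embedding (T T' : finType) (D : pred {set T}) (f : {set T} -> {set T'}) :
  subset_closed D -> D set0 -> (forall v, D [set v]) ->
  (forall A B, D A -> D B -> f A = f B -> A = B) ->
  (forall A B, D A -> D B -> cube_adj A B -> cube_adj (f A) (f B)) ->
  exists2 p : T -> T', injective p &
    forall A, D A -> f A = symdiff (f set0) (p @: A).
Proof.
move=> cD D0 D1 f_inj f_adj.
have adj1 v : exists w, f [set v] == symdiff (f set0) [set w].
  have [|w ->] := f_adj set0 [set v] D0 (D1 v); last by exists w.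
  by exists v; rewrite symdiff1_notin ?inE ?setU0.
pose p v := xchoose (adj1 v).
have pE v : f [set v] = symdiff (f set0) [set p v] by apply/eqP/(xchooseP (adj1 v)).
have p_inj : injective p.
  by move=> v w e; apply/set1_inj/f_inj; rewrite ?D1 // !pE e.
exists p => // A; have [n] := ubnP #|A|; elim: n A => // n IHn A ltAn DA.
have [->|[a aA]] := set_0Vmem A; first by rewrite imset0 symdiff0.
have [eAa|[b]] := set_0Vmem (A :\ a).
  by rewrite -(setD1K aA) eAa setU0 imset_set1 pE.
rewrite in_setD1 => /andP[nba bA].
have nab : a != b by rewrite eq_sym.
(* [B], [A :\ a], [A :\ b] and [A] form a square of the hypercube whose first three corners are
   smaller than [A], so induction reaches them. *)
set B := A :\ a :\ b.
have subA (C : {set T}) x : C \subset A :\ x -> x \in A -> D C /\ f C = symdiff (f set0) (p @: C).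
  move=> sC xA; have DC : D C by apply: cD DA; apply: subset_trans sC (subD1set _ _).
  split=> //; apply: IHn => //; apply: leq_ltn_trans (subset_leq_card sC) _.
  by move: ltAn; rewrite (cardsD1 x A) xA.
have [DB fB] := subA B a (subD1set _ _) aA.
have [DAa fAa] := subA _ a (subxx _) aA.
have [DAb fAb] := subA _ b (subxx _) bA.
have Aa : A :\ a = symdiff B [set b].
  by rewrite symdiff1_notin ?setD11 // setD1K // in_setD1 nba.
have Ab : A :\ b = symdiff B [set a].
  have -> : B = A :\ b :\ a by rewrite /B !setDDl setUC.
  by rewrite symdiff1_notin ?setD11 // setD1K // in_setD1 nab.
have AE : A = symdiff B [set a; b].
  by apply/setP=> x; rewrite !inE; case: eqVneq => [->|_]; case: eqVneq => [->|_];
     rewrite ?aA ?bA ?addbF.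
have adjA x : x \in A -> cube_adj (A :\ x) A.
  by move=> xA; exists x; rewrite symdiff1_notin ?setD11 // setD1K.
have := f_adj _ _ DAa DA (adjA a aA); have := f_adj _ _ DAb DA (adjA b bA).
rewrite fAa fAb Aa Ab !imset_symdiff // !imset_set1 !symdiffA -fB => adja adjb.
(* [f A] is a common neighbour of [f B] shifted by [p a] and by [p b]; injectivity of [f] rules out
   [f B] itself. *)
have [||e] := cube_adj_common _ adja adjb; first by rewrite (inj_eq p_inj).
  by move/(f_inj _ _ DA DB)=> eAB; rewrite eAB !inE eqxx andbF in aA.
by rewrite e fB AE imset_symdiff // imsetU !imset_set1 symdiffA.
Qed.

Lemma complex_iso (T T' : finType) (D : pred {set T}) (D' : pred {set T'})
    (f : {set T} -> {set T'}) (f' : {set T'} -> {set T}) :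
  subset_closed D -> D set0 -> (forall v, D [set v]) ->
  subset_closed D' -> D' set0 -> (forall v, D' [set v]) ->
  (forall A, D A -> D' (f A)) -> (forall A, D' A -> D (f' A)) ->
  (forall A, D A -> f' (f A) = A) -> (forall A, D' A -> f (f' A) = A) ->
  (forall A B, D A -> D B -> cube_adj A B -> cube_adj (f A) (f B)) ->
  (forall A B, D' A -> D' B -> cube_adj A B -> cube_adj (f' A) (f' B)) ->
  #|T| = #|T'| /\ exists g : T' -> T, bijective g /\
    [set S | D S] = [set g @: S | S : {set T'} in [set S | D' S]].
Proof.
move=> cD D0 D1 cD' D0' D1' fD fD' fK fK' f_adj f_adj'.
have [|p p_inj pE] := cube_embedding cD D0 D1 _ f_adj.
  by move=> A B DA DB e; rewrite -(fK A) // e fK.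
(* The reverse embedding supplies only [#|T'| <= #|T|], which makes [p] bijective. *)
have [|q q_inj _] := cube_embedding cD' D0' D1' _ f_adj'.
  by move=> A B DA DB e; rewrite -(fK' A) // e fK'.
have cardT : #|T| = #|T'|.
  by apply/eqP; rewrite eqn_leq (leq_card p p_inj) (leq_card q q_inj).
split=> //; have [g pK gK] : bijective p by apply: inj_card_bij; rewrite ?cardT.
have imK : cancel (fun A : {set T} => p @: A) (fun A : {set T'} => g @: A).
  by move=> A; rewrite -imset_comp (eq_imset _ pK) imset_id.
have imK' : cancel (fun A : {set T'} => g @: A) (fun A : {set T} => p @: A).
  by move=> A; rewrite -imset_comp (eq_imset _ gK) imset_id.
have DE : D =1 (fun A => D' (p @: A)).
  (* Pulling [D'] back along [p] puts both complexes on [T]; the shift [f set0] becomes its image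
     under [g]. *)
  apply: (symdiff_shift_eq (Y := g @: f set0)) => // [A B sAB|B].
    exact/cD'/imsetS.
  rewrite imset_symdiff // imK'; apply/idP/idP=> [DB|DB'].
    by rewrite -pE //; apply: fD.
  (* The preimage under [f] of the shifted set has the form given by [pE]; cancelling the shift and
     [p] identifies it with [B]. *)
  suff -> : B = f' (symdiff (f set0) (p @: B)) by apply: fD'.
  apply: (can_inj imK); apply: (can_inj (symdiffK (f set0))).
  by rewrite -(pE (f' _)) ?fK' //; apply: fD'.
exists g; split; first by exists p.
apply/setP=> A; rewrite inE DE; apply/idP/imsetP=> [D'A|[S]].
  by exists (p @: A); rewrite ?inE ?imK.
by rewrite inE => D'S ->; rewrite imK'.
Qed.

(** A fort that isolates [u] in the larger set still isolates it in any subset containing [u]. *)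
Lemma zpir_set_subset_closed (G : sgraph) : subset_closed (@zpir_set G).
Proof.
move=> A B sAB /forall_inP irB; apply/forall_inP=> u uA.
have /existsP[F /andP[fortF /eqP eF]] := irB u (subsetP sAB u uA).
apply/existsP; exists F; rewrite fortF /= eqEsubset sub1set inE uA.
rewrite -eF setSI //=.
by have: u \in B :&: F; [rewrite eF set11 | rewrite inE => /andP[]].
Qed.

Lemma zpir_set0 (G : sgraph) : zpir_set (set0 : {set G}).
Proof. by apply/forall_inP=> u; rewrite inE. Qed.

(** Connectedness leaves a single component, the whole vertex set, which is a fort because no vertex
    lies outside it. *)
Lemma psd_fort_setT (G : sgraph) : connected_graph G -> psd_fort [set: G].
Proof.
move=> [G_gt0 connG]; rewrite /psd_fort -card_gt0 cardsT G_gt0 /=.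
apply/forall_inP=> C /imsetP[x _ ->].
have -> : [set y in [set: G] | connect (induced_adj [set: G]) x y] = [set: G].
  apply/setP=> y; rewrite !inE; apply: etrans (connG x y).
  by apply: eq_connect => a b; rewrite /induced_adj /= !inE.
rewrite /fort -card_gt0 cardsT G_gt0 /=.
by apply/forall_inP=> v; rewrite !inE.
Qed.

Lemma zpir_set1 (G : sgraph) (v : G) : connected_graph G -> zpir_set [set v].
Proof.
move=> connG; apply/forall_inP=> u /set1P ->; apply/existsP; exists setT.
by rewrite psd_fort_setT // setIT eqxx.
Qed.

Section TarMap.

Variables (G G' : sgraph) (phi : tar_graph G -> tar_graph G').

(** Extends [phi] to all sets so that the hypercube lemmas apply; the default [set0] is taken only
    off the Z+Ir-sets. *)
Definition tar_map (A : {set G}) : {set G'} :=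
  if insub A : option (tar_vertex G) is Some a then val (phi a) else set0.

Lemma tar_map_val (a : tar_graph G) : tar_map (val a) = val (phi a).
Proof. by rewrite /tar_map valK. Qed.

Lemma tar_map_zpir A : zpir_set A -> zpir_set (tar_map A).
Proof.
move=> irA; rewrite -[A]/(val (Sub A irA : tar_vertex G)) tar_map_val.
exact: valP.
Qed.

Lemma tar_map_cube_adj A B :
  (forall x y, adj x y -> adj (phi x) (phi y)) ->
  zpir_set A -> zpir_set B -> cube_adj A B -> cube_adj (tar_map A) (tar_map B).
Proof.
move=> phi_adj irA irB adjAB.
rewrite -[A]/(val (Sub A irA : tar_vertex G)) -[B]/(val (Sub B irB : tar_vertex G)).
by rewrite !tar_map_val; apply/adds_one_cube_adj/phi_adj/adds_one_cube_adj.
Qed.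

End TarMap.

Lemma tar_mapK (G G' : sgraph) (phi : tar_graph G -> tar_graph G')
    (psi : tar_graph G' -> tar_graph G) A :
  cancel phi psi -> zpir_set A -> tar_map psi (tar_map phi A) = A.
Proof.
move=> phiK irA; rewrite -[A]/(val (Sub A irA : tar_vertex G)).
by rewrite !tar_map_val phiK.
Qed.

Theorem theorem3p23 (G G' : sgraph)
  (connG : connected_graph G) (connG' : connected_graph G')
  (isoG : no_isolated G) (isoG' : no_isolated G')
  (tar_iso : graph_iso (tar_graph G) (tar_graph G')) :
  #|G| = #|G'| /\
  exists g : G' -> G, bijective g /\
    zpir_sets G = [set g @: S | S : {set G'} in zpir_sets G'].
Proof.
have [phi [[psi phiK psiK] phi_adj]] := tar_iso.
apply: (complex_iso (f := tar_map phi) (f' := tar_map psi)) => [||v|||v|||||A B|A B].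
- exact: zpir_set_subset_closed.
- exact: zpir_set0.
- exact: zpir_set1.
- exact: zpir_set_subset_closed.
- exact: zpir_set0.
- exact: zpir_set1.
- exact: tar_map_zpir.
- exact: tar_map_zpir.
- by move=> A; apply: tar_mapK.
- by move=> A; apply: tar_mapK.
- by apply: tar_map_cube_adj => x y; rewrite phi_adj.
(* Since [phi] also reflects adjacency, its inverse [psi] preserves it. *)
- by apply: tar_map_cube_adj => x y; rewrite -phi_adj !psiK.
Qed.
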